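(* The norms $\|\cdot\|_{MK}$ and $\|\cdot\|_{MK}^{*}$ are equivalent on $cabv(X,0)$. More precisely, for every $\mu\in cabv(X,0)$ one has $$\|\mu\|_{MK}\le\|\mu\|_{MK}^{*}\le\|\mu\|_{MK}\,(\operatorname{diam}(T)+1)$$ and $$\|\mu\|_{MK}\le\|\mu\|_{MK}^{*}\le\|\mu\|\,\operatorname{diam}(T).$$
   Context: $(T,d)$ is a compact metric space with at least two elements, with Borel $\sigma$-algebra $\mathcal{B}$; $\operatorname{diam}(T)=\sup\{d(x,y):x,y\in T\}$. $X$ is a nonzero Hilbert space over $K$ ($K=\mathbb{R}$ or $K=\mathbb{C}$), with scalar product $(\cdot\mid\cdot)$ (linear in the first variable, conjugate-linear in the second) and norm $\|\cdot\|$. $C(X)$ is the space of continuous functions $f:T\to X$ with the sup norm $\|f\|=\sup_{t\in T}\|f(t)\|$. $cabv(X)$ is the vector space over $K$ of $\sigma$-additive measures $\mu:\mathcal{B}\to X$ of bounded variation, where the variation is $|\mu|(A)=\sup\sum_i\|\mu(A_i)\|$ over finite partitions $(A_i)$ of $A$ into Borel sets; $\|\mu\|=|\mu|(T)$ is the variational norm. $cabv(X,0)=\{\mu\in cabv(X):\mu(T)=0\}$. Integral: for a simple function $f=\sum_{i=1}^m\varphi_{A_i}x_i$ ($A_i\in\mathcal{B}$, $x_i\in X$, $\varphi_{A}$ the indicator function of $A$) put $\int f\,d\mu=\sum_{i=1}^m(x_i\mid\mu(A_i))\in K$; for $f\in C(X)$ put $\int f\,d\mu=\lim_n\int f_n\,d\mu$,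 where $(f_n)$ is any sequence of simple functions converging uniformly to $f$ (the limit exists and does not depend on the sequence; the integral is linear in $f$, conjugate-linear in $\mu$, and $|\int f\,d\mu|\le\|\mu\|\|f\|$). $L(X)$ is the space of Lipschitz functions $f:T\to X$, $\|f\|_L$ is the least Lipschitz constant of $f$, $\|f\|_{BL}=\|f\|+\|f\|_L$, $BL_1(X)=\{f\in L(X):\|f\|_{BL}\le1\}$, $L_1(X)=\{f\in L(X):\|f\|_L\le1\}$. The Monge-Kantorovich norm on $cabv(X)$ is $\|\mu\|_{MK}=\sup\{|\int f\,d\mu|: f\in BL_1(X)\}$; the modified Monge-Kantorovich norm on $cabv(X,0)$ is $\|\mu\|_{MK}^{*}=\sup\{|\int f\,d\mu|: f\in L_1(X)\}$. *)

(* Defs.v *)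
From HB Require Import structures.
From mathcomp Require Import all_boot all_order all_algebra.
From mathcomp Require Import complex.
From mathcomp Require Import all_classical all_reals all_analysis.

Set Implicit Arguments.
Unset Strict Implicit.
Unset Printing Implicit Defensive.

Import Order.TTheory GRing.Theory Num.Theory.
Import numFieldNormedType.Exports.

Local Open Scope classical_set_scope.
Local Open Scope ring_scope.

Inductive scalars := RealScalars | ComplexScalars.

Definition scalar_field (R : realType) (k : scalars) : numFieldType :=
  match k with
  | RealScalars => R
  | ComplexScalars => R[i]
  end.

Definition scalar_conj (R : realType) (k : scalars) :
    scalar_field R k -> scalar_field R k :=
  match k with
  | RealScalars => fun z : R => z
  | ComplexScalars => fun z : R[i] => conjc z
  end.

Definition scalar_Re (R : realType) (k : scalars) : scalar_field R k -> R :=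
  match k with
  | RealScalars => fun z : R => z
  | ComplexScalars => fun z : R[i] => complex.Re z
  end.

(* The norm of a normed module over K takes its values in K; [rnorm] is the
   same norm with values in R. *)
Definition rnorm (R : realType) (k : scalars)
    (V : normedModType (scalar_field R k)) (x : V) : R :=
  scalar_Re `|x|.

(* Suprema are taken in \bar R, so that none of them gets a default value. *)

Section metric.
Context {R : realType} (T : metricType R).

Definition diam : \bar R :=
  ereal_sup [set (mdist p.1 p.2)%:E | p in [set: T * T]].

Definition borel : set (set T) := <<s [set U : set T | open U] >>.

End metric.

Section functions.
Context {R : realType} {k : scalars} {T : metricType R}.
Context {X : normedModType (scalar_field R k)}.
Implicit Types f : T -> X.

Definition sup_norm f : \bar R := ereal_sup [set (rnorm (f t))%:E | t in setT].

Definition lipschitz_const f : set R :=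
  [set L | 0 <= L /\ forall x y, rnorm (f x - f y) <= L * mdist x y].

Definition lip_space : set (T -> X) := [set f | exists L, lipschitz_const f L].

Definition lip_norm f : \bar R := ereal_inf [set L%:E | L in lipschitz_const f].

Definition bl_norm f : \bar R := (sup_norm f + lip_norm f)%E.

Definition BL1 : set (T -> X) := [set f | lip_space f /\ (bl_norm f <= 1)%E].

Definition L1 : set (T -> X) := [set f | lip_space f /\ (lip_norm f <= 1)%E].

End functions.

(* A vector measure is represented by a total function on [set T], of which
   only the values on Borel sets are ever used. *)
Section vector_measures.
Context {R : realType} {k : scalars} {T : metricType R}.
Context {X : normedModType (scalar_field R k)}.
Implicit Types mu : set T -> X.

Definition vector_sigma_additive mu : Prop :=
  forall F : nat -> set T, (forall n, borel (F n)) -> trivIset setT F ->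
    (fun n => \sum_(0 <= i < n) mu (F i)) @ \oo --> mu (\bigcup_n F n).

Definition borel_partition (A : set T) (n : nat) (F : 'I_n -> set T) : Prop :=
  [/\ forall i, borel (F i), trivIset setT F & \bigcup_i F i = A].

Definition vector_variation mu (A : set T) : \bar R :=
  ereal_sup [set v | exists (n : nat) (F : 'I_n -> set T),
    borel_partition A F /\ v = (\sum_(i < n) rnorm (mu (F i)))%:E].

Definition var_norm mu : \bar R := vector_variation mu setT.

Definition cabv : set (set T -> X) :=
  [set mu | vector_sigma_additive mu /\ (var_norm mu < +oo)%E].

Definition cabv0 : set (set T -> X) := [set mu | cabv mu /\ mu setT = 0].

End vector_measures.

Section integral.
Context {R : realType} {k : scalars} {T : metricType R}.
Context {X : normedModType (scalar_field R k)}.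
Context (dot : {dot X for @scalar_conj R k}).
Implicit Types (mu : set T -> X) (s : seq (set T * X)).

(* The list of the pairs (A_i, x_i) represents the simple function
   \sum_i \1_(A_i) x_i; the A_i need not be disjoint. *)
Definition simple_fun s (t : T) : X :=
  \sum_(p <- s) (\1_(p.1) t : scalar_field R k) *: p.2.

Definition simple_int s mu : scalar_field R k := \sum_(p <- s) dot p.2 (mu p.1).

Definition is_vint (f : T -> X) mu (l : scalar_field R k) : Prop :=
  exists s_ : nat -> seq (set T * X),
    [/\ forall n p, p \in s_ n -> borel p.1,
        {uniform, (fun n => simple_fun (s_ n)) @ \oo --> f}
      & (fun n => simple_int (s_ n) mu) @ \oo --> l].

(* [is_vint f mu] holds of exactly one scalar when f is continuous, T is
   compact and mu is in [cabv]; the default value 0 is then not used. *)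
Definition vint (f : T -> X) mu : scalar_field R k := xget 0 (is_vint f mu).

Definition mk_norm mu : \bar R :=
  ereal_sup [set (scalar_Re `|vint f mu|)%:E | f in BL1].

Definition mk_star_norm mu : \bar R :=
  ereal_sup [set (scalar_Re `|vint f mu|)%:E | f in L1].

End integral.

Definition equivalent_norms_on {R : realType} {V : Type} (D : set V)
    (N N' : V -> \bar R) : Prop :=
  exists c C : R, [/\ 0 < c, 0 < C &
    forall v, D v -> (c%:E * N v <= N' v)%E /\ (N' v <= C%:E * N v)%E].

(* Main.v *)
(** A simple function can be rewritten over a finite Borel partition; the
    Cauchy-Schwarz inequality on each cell then gives |∫ f dmu| <= ||mu|| ||f||,
    first for simple functions and then for uniform limits.  Since mu(T) = 0, the
    integral does not change when a constant vector is subtracted from f.  For f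
    in L_1(X) and a point t0 the function f - f(t0) is bounded by diam(T), whence
    |∫ f dmu| <= ||mu|| diam(T), and (f - f(t0)) / (diam(T) + 1) lies in BL_1(X),
    whence |∫ f dmu| <= (diam(T) + 1) ||mu||_MK. *)
Require Import Defs.
From HB Require Import structures.
From mathcomp Require Import all_boot all_order all_algebra.
From mathcomp Require Import complex.
From mathcomp Require Import all_classical all_reals all_analysis.
Import Order.TTheory GRing.Theory Num.Theory.
Import numFieldNormedType.Exports.
Local Open Scope classical_set_scope.
Local Open Scope ring_scope.

(** * Real parts and real constants in the scalar field *)

Section scalars.
Context {R : realType} {k : scalars}.
Local Notation K := (scalar_field R k).
Implicit Types a b : K.

(** Norms and radii take values in K, so real tolerances and factors such as
    $1/(\operatorname{diam}(T)+1)$ must be carried there. *)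
Definition scalar_of_real (r : R) : K :=
  match k return scalar_field R k with
  | RealScalars => r
  | ComplexScalars => r%:C%C
  end.

Lemma le_scalar_Re a b : a <= b -> scalar_Re a <= scalar_Re b.
Proof. by case: k a b => //= -[a a'] [b b'] /andP[]. Qed.

Lemma scalar_ReD a b : scalar_Re (a + b) = scalar_Re a + scalar_Re b.
Proof. by case: k a b => //= -[a a'] [b b']. Qed.

(** In [R[i]], [0 <= a] forces the imaginary part to vanish, so the cross term of the product
    disappears. *)
Lemma scalar_ReM a b : 0 <= a -> 0 <= b ->
  scalar_Re (a * b) = scalar_Re a * scalar_Re b.
Proof.
case: k a b => //= -[a a'] [b b'] /andP[/= /eqP -> _] /andP[/= /eqP -> _].
by rewrite mulr0 subr0.
Qed.

Lemma scalar_of_realK r : scalar_Re (scalar_of_real r) = r.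
Proof. by rewrite /scalar_of_real; case: k. Qed.

Lemma scalar_ReK a : 0 <= a -> scalar_of_real (scalar_Re a) = a.
Proof.
rewrite /scalar_of_real; case: k a => //= -[a a'] /andP[/= /eqP -> _].
by [].
Qed.

Lemma le_scalar_of_real r s : (scalar_of_real r <= scalar_of_real s) = (r <= s).
Proof. by rewrite /scalar_of_real; case: k => //; rewrite lecR. Qed.

Lemma scalar_of_real0 : scalar_of_real 0 = 0.
Proof. by rewrite /scalar_of_real; case: k. Qed.

Lemma scalar_of_real_gt0 r : (0 < scalar_of_real r) = (0 < r).
Proof.
by rewrite -scalar_of_real0 !lt_def !le_scalar_of_real (can_eq scalar_of_realK).
Qed.

Lemma scalar_mul_conj a : a * scalar_conj a = `|a| ^+ 2.
Proof.
case: k a => /= a; first by rewrite real_normK ?num_real.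
by rewrite [RHS]normCK.
Qed.

End scalars.

Arguments scalar_of_real {R} k r.

(** * The real-valued norm and convergence with real tolerances *)

Section rnorm.
Context {R : realType} {k : scalars} {V : normedModType (scalar_field R k)}.
Implicit Types x y : V.

Lemma rnorm_ge0 x : 0 <= rnorm x.
Proof. by rewrite -(@scalar_of_realK R k 0) scalar_of_real0 le_scalar_Re. Qed.

Lemma rnorm0 : rnorm (0 : V) = 0.
Proof. by rewrite /rnorm normr0 -(@scalar_of_real0 R k) scalar_of_realK. Qed.

Lemma rnorm_eq0 x : rnorm x = 0 -> x = 0.
Proof.
move=> x0; apply: normr0_eq0.
by rewrite -[LHS]scalar_ReK// -/(rnorm x) x0 scalar_of_real0.
Qed.

Lemma rnormN x : rnorm (- x) = rnorm x.
Proof. by rewrite /rnorm normrN. Qed.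

Lemma rnormD x y : rnorm (x + y) <= rnorm x + rnorm y.
Proof. by rewrite /rnorm -scalar_ReD le_scalar_Re ?ler_normD. Qed.

Lemma rnormZ (a : scalar_field R k) x :
  rnorm (a *: x) = scalar_Re `|a| * rnorm x.
Proof. by rewrite /rnorm normrZ scalar_ReM. Qed.

Lemma rnorm_sum I (r : seq I) (F : I -> V) :
  rnorm (\sum_(i <- r) F i) <= \sum_(i <- r) rnorm (F i).
Proof.
elim: r => [|i r IH]; first by rewrite !big_nil rnorm0.
by rewrite !big_cons (le_trans (rnormD _ _))// lerD2l.
Qed.

(** Positive elements of K are exactly the images of positive reals, so tolerances in K and in R
    express the same convergence. *)
Lemma rnorm_cvgP {F : set_system V} {FF : Filter F} x :
  F --> x <-> forall e : R, 0 < e -> \forall y \near F, rnorm (x - y) <= e.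
Proof.
split=> [/cvgrPdist_le Fx e e0|Fx].
  have := Fx (scalar_of_real k e); rewrite scalar_of_real_gt0 => /(_ e0).
  by apply: filterS => y /(@le_scalar_Re R k); rewrite scalar_of_realK.
apply/cvgrPdist_le => e e0.
have eE := scalar_ReK _ (ltW e0).
have := Fx (scalar_Re e); rewrite -(@scalar_of_real_gt0 _ k) eE => /(_ e0).
apply: filterS => y; rewrite -(@le_scalar_of_real _ k) eE.
by rewrite scalar_ReK.
Qed.

Lemma rnorm_uniform_cvgP (T : choiceType) (u : nat -> T -> V) (f : T -> V) :
  {uniform, u @ \oo --> f} <->
  forall e : R, 0 < e -> \forall n \near \oo, forall t, rnorm (f t - u n t) <= e.
Proof.
split=> [uf e e0|uf].
  have : (u @ \oo) [set h | forall t, setT t ->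
      [set xy : V * V | ball xy.1 (scalar_of_real k e) xy.2] (f t, h t)].
    apply: uf; apply/uniform_nbhs.
    exists [set xy : V * V | ball xy.1 (scalar_of_real k e) xy.2].
    split=> //; rewrite -entourage_ballE.
    by exists (scalar_of_real k e) => //=; rewrite scalar_of_real_gt0.
  apply: (@filterS _ \oo) => n /= ufn t.
  have /(_ I) := ufn t; rewrite -ball_normE /= => /ltW /(@le_scalar_Re R k).
  by rewrite scalar_of_realK.
move=> A /uniform_nbhs[E [entE EA]].
have [e /= e0 eE] : exists2 e : scalar_field R k, 0 < e &
    [set xy : V * V | ball xy.1 e xy.2] `<=` E.
  by move: entE; rewrite -entourage_ballE => -[e e0 eE]; exists e.
(* Halving turns the large inequality of the hypothesis into the strict one that defines the
   ball. *)
have e20 : 0 < e / 2 by rewrite divr_gt0.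
have e2E := scalar_ReK _ (ltW e20).
have := uf (scalar_Re (e / 2)); rewrite -(@scalar_of_real_gt0 _ k) e2E => /(_ e20).
apply: (@filterS _ \oo) => n un; apply: EA => t _; apply: eE => /=.
rewrite -ball_normE /=; have := un t; rewrite -(@le_scalar_of_real _ k) e2E.
rewrite scalar_ReK// => /le_lt_trans; apply.
by rewrite ltr_pdivrMr// ltr_pMr// ltr1n.
Qed.

End rnorm.

(** * Closure properties of the Borel sets *)

Section borel.
Context {R : realType} {T : metricType R}.
Implicit Types A B : set T.

Lemma borel0 : borel (set0 : set T).
Proof. by apply sigma_algebra0. Qed.

Lemma borelC A : borel A -> borel (~` A).
Proof. by move=> bA; rewrite -setTD; apply sigma_algebraCD. Qed.

Lemma borelT : borel [set: T].
Proof. by rewrite -setC0; exact: (borelC _ borel0). Qed.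

Lemma borelU A B : borel A -> borel B -> borel (A `|` B).
Proof.
move=> bA bB; rewrite -bigcup2E; apply sigma_algebra_bigcup.
by case=> [|[|n]]//=; exact: borel0.
Qed.

Lemma borelI A B : borel A -> borel B -> borel (A `&` B).
Proof.
move=> /borelC bA /borelC bB.
by rewrite -[A `&` B]setCK setCI; exact: (borelC _ (borelU _ _ bA bB)).
Qed.

Lemma borelD A B : borel A -> borel B -> borel (A `\` B).
Proof. by move=> bA /borelC bB; rewrite setDE; exact: borelI. Qed.

End borel.

(** * Finite additivity from sigma-additivity *)

Section vector_measure.
Context {R : realType} {k : scalars} {T : metricType R}.
Context {X : normedModType (scalar_field R k)}.
Variable mu : set T -> X.
Hypothesis mu_sigma : vector_sigma_additive mu.

(** Along the constant sequence of empty sets the partial sums converge, so their successive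
    differences, all equal to [mu set0], tend to 0. *)
Lemma vector_measure0 : mu set0 = 0.
Proof.
have tF : trivIset [set: nat] (fun=> set0 : set T) by move=> i j _ _ [x [[]]].
have := mu_sigma _ (fun=> borel0) tF; rewrite bigcup0// => muc.
have mucS := muc; rewrite -cvg_shiftS in mucS.
have := cvgB mucS muc _; rewrite subrr => mu0.
apply: (cvg_unique (@norm_hausdorff _ X)) (mu0 _).
apply: cvg_near_cst; near=> n.
by rewrite /= !fctE big_nat_recr//= addrC addKr.
Unshelve. all: by end_near. Qed.

Lemma vector_measureU A B : borel A -> borel B -> A `&` B = set0 ->
  mu (A `|` B) = mu A + mu B.
Proof.
move=> bA bB AB.
have bF n : borel (bigcup2 A B n) by case: n => [|[|n]]//=; exact: borel0.
have tF : trivIset setT (bigcup2 A B) by rewrite -trivIset_bigcup2.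
have := mu_sigma _ bF tF; rewrite bigcup2E => muAB.
apply: (cvg_unique (@norm_hausdorff _ X) muAB).
(* The sequence A, B, set0, set0, ... has constant partial sums from index 2 on. *)
apply: cvg_near_cst; exists 2%N => // -[|[|n]]// _.
rewrite !big_nat_recl//= big1 ?addr0// => i _.
exact: vector_measure0.
Qed.

Lemma vector_measureID A B : borel A -> borel B ->
  mu A = mu (A `&` B) + mu (A `\` B).
Proof.
move=> bA bB; rewrite -[in LHS](setUIDK A B) vector_measureU//.
- exact: borelI.
- exact: borelD.
- by rewrite -subset0 => x [[_ Bx] [_ /(_ Bx)]].
Qed.
End vector_measure.

(** * The scalar product and the integral of simple functions *)

Section simple_integral.
Context {R : realType} {k : scalars} {T : metricType R}.
Context {X : normedModType (scalar_field R k)}.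
Variable dot : {dot X for @scalar_conj R k}.
Hypothesis normE : forall x : X, `|x| ^+ 2 = dot x x.
Implicit Types (s : seq (set T * X)) (mu : set T -> X).

Lemma dot_conjC x y : dot x y = scalar_conj (dot y x).
Proof. by case: dot => f /= [_ _ [->]]; rewrite expr0 mul1r. Qed.

Lemma dotDl x y z : dot (x + y) z = dot x z + dot y z.
Proof. exact: linearDl. Qed.

Lemma dotDr x y z : dot x (y + z) = dot x y + dot x z.
Proof. exact: linearDr. Qed.

Lemma dotBl x y z : dot (x - y) z = dot x z - dot y z.
Proof. exact: linearBl. Qed.

Lemma dotBr x y z : dot x (y - z) = dot x y - dot x z.
Proof. exact: linearBr. Qed.

Lemma dotZl a x y : dot (a *: x) y = a * dot x y.
Proof. exact: linearZl_LR. Qed.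

Lemma dotZr a x y : dot x (a *: y) = scalar_conj a * dot x y.
Proof. exact: linearZr_LR. Qed.

(* Positivity of [dot z z] for [z = |y|^2 x - (x|y) y], which is orthogonal to
   [y]; scaling by [|y|^2] avoids conjugating a quotient. *)
Lemma cauchy_schwarz x y : scalar_Re `|dot x y| <= rnorm x * rnorm y.
Proof.
rewrite -scalar_ReM// le_scalar_Re//.
have [->|y0] := eqVneq y 0; first by rewrite linear0r !normr0 mulr0.
have yy0 : 0 < `|y| ^+ 2 by rewrite exprn_gt0// normr_gt0.
rewrite -ler_sqr ?nnegrE ?mulr_ge0// exprMn mulrC -subr_ge0 -(pmulr_rge0 _ yy0).
pose z := `|y| ^+ 2 *: x - dot x y *: y.
have zy : dot z y = 0 by rewrite dotBl !dotZl normE mulrC subrr.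
suff -> : `|y| ^+ 2 * (`|y| ^+ 2 * `|x| ^+ 2 - `|dot x y| ^+ 2) = `|z| ^+ 2.
  by rewrite exprn_ge0.
have conj0 : scalar_conj (0 : scalar_field R k) = 0.
  by rewrite -(linear0l dot 0) -dot_conjC.
have yz : dot y z = 0 by rewrite dot_conjC zy conj0.
rewrite [RHS]normE [dot z z]dotBl !dotZl yz mulr0 subr0.
rewrite [dot x z]dotBr !dotZr [scalar_conj (dot x y) * _]mulrC scalar_mul_conj.
(* $\|y\|^2=(y\mid y)$ is its own conjugate by Hermitian symmetry. *)
by rewrite [in scalar_conj _]normE -dot_conjC -!normE.
Qed.

Lemma simple_fun_cons p s t :
  simple_fun (p :: s) t = (\1_(p.1) t : scalar_field R k) *: p.2 + simple_fun s t.
Proof. by rewrite /simple_fun big_cons. Qed.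

Lemma simple_int_cons p s mu :
  simple_int dot (p :: s) mu = dot p.2 (mu p.1) + simple_int dot s mu.
Proof. by rewrite /simple_int big_cons. Qed.

(* The splitting identity for every Borel set [B] makes the induction on [s] go
   through with binary additivity of [mu] only. *)
Lemma simple_fun_refine mu s : vector_sigma_additive mu ->
  (forall p, p \in s -> borel p.1) ->
  exists (I : finType) (F : I -> set T) (c : I -> X),
    [/\ forall i, borel (F i), trivIset setT F, \bigcup_i F i = setT &
    [/\ forall B, borel B -> mu B = \sum_i mu (B `&` F i),
      forall i t, F i t -> simple_fun s t = c i &
      simple_int dot s mu = \sum_i dot (c i) (mu (F i))]].
Proof.
move=> mus; elim: s => [_|[A x] s IH sb].
  exists unit, (fun=> setT), (fun=> 0); split.
  - by move=> _; exact: borelT.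
  - by move=> [] [].
  - by apply/seteqP; split=> // t _; exists tt.
  - split=> [B _|_ t _|].
    + by rewrite (big_pred1 tt) ?setIT// => -[].
    + by rewrite /simple_fun big_nil.
    + by rewrite /simple_int big_nil big1// => i _; rewrite linear0l.
have [|I [F [c [bF tF cF [muF sF intF]]]]] := IH.
  by move=> p ps; apply: sb; rewrite inE ps orbT.
have bA : borel A by apply: (sb (A, x)); rewrite mem_head.
(* Each old cell is cut along A; the half inside A gains the value x. *)
pose G (j : I * bool) := F j.1 `&` (if j.2 then A else ~` A).
have bG j : borel (G j) by apply: borelI => //; case: j.2 => //; exact: borelC.
exists (I * bool)%type, G, (fun j => (if j.2 then x else 0) + c j.1); split=> //.
- move=> [i b] [j b'] _ _ [t [[/= Fi tb] [/= Fj tb']]].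
  have -> : i = j by apply: tF => //; exists t.
  by case: b b' tb tb' => -[].
- apply/seteqP; split=> // t _.
  have [i _ Fi] : (\bigcup_i F i) t by rewrite cF.
  have [At|At] := pselect (A t); first by exists (i, true).
  by exists (i, false).
- split=> [B bB|[i b] t [/= Fi tb]|].
  + rewrite muF// -(pair_bigA _ (fun i b => mu (B `&` G (i, b)))) /=.
    apply: eq_bigr => i _; rewrite big_bool /G /= (vector_measureID _ mus _ A)//.
      by rewrite setDE !setIA.
    exact: borelI.
  + rewrite simple_fun_cons (sF i)// indicE /=; congr (_ + _).
    by case: b tb => /= tb; [rewrite mem_set// scale1r|rewrite memNset// scale0r].
  (* The new term $(x\mid\mu(A))$ is spread over the cells by the splitting identity at B = A. *)
  + rewrite simple_int_cons /= intF muF// linear_sumr -big_split /=.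
    rewrite -(pair_bigA _
      (fun i b => dot ((if b then x else 0) + c i) (mu (G (i, b))))) /=.
    apply: eq_bigr => i _; rewrite big_bool /G /= add0r dotDl.
    rewrite (vector_measureID _ mus (F i) A)// -setDE setIC dotDr.
    by rewrite addrA.
Qed.

(** The variation ranges over partitions indexed by ordinals, while refinement yields an arbitrary
    finite index type; enumerating that type bridges the two. *)
Lemma sum_rnorm_le_var_norm (I : finType) (F : I -> set T) mu :
  (forall i, borel (F i)) -> trivIset setT F -> \bigcup_i F i = setT ->
  ((\sum_i rnorm (mu (F i)))%:E <= var_norm mu)%E.
Proof.
move=> bF tF cF; apply: ereal_sup_ubound.
exists #|I|, (fun i => F (enum_val i)); split; last first.
  by rewrite (reindex_onto enum_val enum_rank)//= => [|i _];
    rewrite ?enum_rankK//; congr EFin; apply: eq_bigl => i; rewrite enum_valK eqxx.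
split=> //.
- by move=> i j _ _ /(tF _ _ Logic.I Logic.I); exact: enum_val_inj.
- apply/seteqP; split=> // t; rewrite -cF => -[i _ Fi].
  by exists (enum_rank i) => //; rewrite enum_rankK.
Qed.

Lemma var_norm_ge0 mu : (0 <= var_norm mu)%E.
Proof.
apply: le_trans (sum_rnorm_le_var_norm unit (fun=> setT) mu _ _ _).
- by rewrite lee_fin sumr_ge0// => i _; exact: rnorm_ge0.
- by move=> _; exact: borelT.
- by move=> [] [].
- by apply/seteqP; split=> // t _; exists tt.
Qed.

Lemma cabv_var_normE mu : cabv mu -> var_norm mu = (fine (var_norm mu))%:E.
Proof. by move=> [_ mu_fin]; rewrite fineK// ge0_fin_numE// var_norm_ge0. Qed.

Lemma simple_int_le mu s (M V : R) : vector_sigma_additive mu ->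
  (forall p, p \in s -> borel p.1) -> 0 <= M -> (var_norm mu <= V%:E)%E ->
  (forall t, rnorm (simple_fun s t) <= M) ->
  scalar_Re `|simple_int dot s mu| <= V * M.
Proof.
move=> mus sb M0 muV sM.
have [I [F [c [bF tF cF [muF sF ->]]]]] := simple_fun_refine mu s mus sb.
(* K is viewed as a normed module over itself, so that the triangle inequality for [rnorm] applies
   to scalars. *)
apply: (le_trans (@rnorm_sum _ _ (scalar_field R k)^o _ _ _)).
have /le_trans/(_ muV) := sum_rnorm_le_var_norm _ _ mu bF tF cF.
rewrite lee_fin => FV.
apply: le_trans (ler_wpM2r M0 FV); rewrite mulr_suml; apply: ler_sum => i _.
apply: le_trans (cauchy_schwarz _ _) _; rewrite mulrC.
(* The value [c i] is bounded by M only if some point of the cell attains it; an empty cell has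
   measure 0 and contributes nothing. *)
have [->|/set0P[t Ft]] := eqVneq (F i) set0.
  by rewrite vector_measure0// rnorm0 !mul0r.
by rewrite ler_wpM2l ?rnorm_ge0// -(sF i t).
Qed.

End simple_integral.

(** * Linearity and boundedness of the integral as a uniform limit *)

Section vint.
Context {R : realType} {k : scalars} {T : metricType R}.
Context {X : normedModType (scalar_field R k)}.
Variable dot : {dot X for @scalar_conj R k}.
Hypothesis normE : forall x : X, `|x| ^+ 2 = dot x x.
Variable mu : set T -> X.
Local Notation K := (scalar_field R k).
Implicit Types (f g : T -> X) (l : K).

Lemma scalar_cvgP (u : nat -> K) l : u @ \oo --> l <->
  forall e : R, 0 < e -> \forall n \near \oo, scalar_Re `|l - u n| <= e.
Proof. exact: (@rnorm_cvgP R k K^o (u @ \oo)). Qed.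

Lemma is_vint_cst c : is_vint dot (fun=> c) mu (dot c (mu setT)).
Proof.
exists (fun=> [:: (setT, c)]); split.
- by move=> _ p; rewrite inE => /eqP ->; exact: borelT.
- apply/rnorm_uniform_cvgP => e e0; near=> n => t.
  rewrite simple_fun_cons /simple_fun big_nil indicE in_setT scale1r addr0 subrr.
  by rewrite rnorm0 ltW.
- apply: cvg_near_cst; near=> n.
  by rewrite simple_int_cons /simple_int big_nil addr0.
Unshelve. all: by end_near. Qed.

Lemma is_vintZD (a : K) f g l l' : is_vint dot f mu l -> is_vint dot g mu l' ->
  is_vint dot (fun t => a *: f t + g t) mu (a * l + l').
Proof.
move=> [s [sb sf sl]] [s' [s'b s'f s'l]].
exists (fun n => [seq (p.1, a *: p.2) | p <- s n] ++ s' n); split.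
- move=> n p; rewrite mem_cat => /orP[/mapP[q qs ->]|/s'b//]; exact: (sb n q).
- move/rnorm_uniform_cvgP : sf => sf; move/rnorm_uniform_cvgP : s'f => s'f.
  have ge0 : 0 <= scalar_Re `|a| by exact: (@rnorm_ge0 _ _ K^o).
  (* With both errors at most $e/(|a|+1)$, the total is at most $|a|\,e/(|a|+1)+e/(|a|+1)=e$; the
     added 1 also covers a = 0. *)
  have gt0 : 0 < scalar_Re `|a| + 1 by rewrite ltr_wpDl.
  apply/rnorm_uniform_cvgP => e e0.
  have e'0 : 0 < e / (scalar_Re `|a| + 1) by rewrite divr_gt0.
  near=> n => t.
  have -> : a *: f t + g t - simple_fun
      ([seq (p.1, a *: p.2) | p <- s n] ++ s' n) t =
      a *: (f t - simple_fun (s n) t) + (g t - simple_fun (s' n) t).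
    rewrite scalerBr addrACA -opprD; congr (_ - _).
    rewrite /simple_fun big_cat big_map scaler_sumr; congr (_ + _).
    by apply: eq_bigr => p _; rewrite !scalerA mulrC.
  apply: le_trans (rnormD _ _) _; rewrite rnormZ.
  rewrite -[leRHS](divfK (lt0r_neq0 gt0)) mulrDr mulr1 mulrC lerD//.
    rewrite ler_wpM2r//; move: t; near: n; exact: sf.
  by move: t; near: n; exact: s'f.
- have -> : (fun n => simple_int dot ([seq (p.1, a *: p.2) | p <- s n] ++ s' n) mu) =
      (fun n => a * simple_int dot (s n) mu + simple_int dot (s' n) mu).
    apply/funext => n; rewrite /simple_int big_cat big_map mulr_sumr; congr (_ + _).
    by apply: eq_bigr => p _; exact: dotZl.
  by apply: cvgD s'l; apply: cvgMr.
Unshelve. all: by end_near. Qed.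

Hypothesis mu_sigma : vector_sigma_additive mu.

Variable V : R.
Hypothesis muV : (var_norm mu <= V%:E)%E.

Lemma is_vint_le f l (M : R) : 0 <= M -> (forall t, rnorm (f t) <= M) ->
  is_vint dot f mu l -> scalar_Re `|l| <= V * M.
Proof.
move=> M0 fM [s [sb /rnorm_uniform_cvgP sf /scalar_cvgP sl]].
have V0 : 0 <= V by rewrite -lee_fin (le_trans _ muV)// var_norm_ge0.
have V10 : 0 < V + 1 by rewrite ltr_wpDl.
apply/ler_addgt0Pr => e e0.
(* With $e'=e/(V+1)$, the integral is off by $e'$ and the simple function is bounded by $M+e'$; this
   gives $e'+V(M+e')=VM+e$. *)
have e'0 : 0 < e / (V + 1) by rewrite divr_gt0.
have [n [sfn sln]] : exists n,
    (forall t, rnorm (f t - simple_fun (s n) t) <= e / (V + 1)) /\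
    scalar_Re `|l - simple_int dot (s n) mu| <= e / (V + 1).
  have /filter_ex// : \forall n \near \oo,
    (forall t, rnorm (f t - simple_fun (s n) t) <= e / (V + 1)) /\
    scalar_Re `|l - simple_int dot (s n) mu| <= e / (V + 1).
  by near=> n; split; near: n; [exact: sf|exact: sl].
have sM t : rnorm (simple_fun (s n) t) <= M + e / (V + 1).
  rewrite -[simple_fun _ t](subKr (f t)) (le_trans (rnormD _ _))//.
  by rewrite rnormN lerD.
have := simple_int_le dot normE mu (s n) _ V mu_sigma (sb n) _ muV sM.
move=> /(_ (addr_ge0 M0 (ltW e'0))) sV.
rewrite -[l](subrK (simple_int dot (s n) mu)).
apply: le_trans (@rnormD _ _ K^o _ _) _; apply: le_trans (lerD sln sV) _.
rewrite mulrDr addrCA lerD2l -[X in X + _]mul1r -mulrDl [1 + V]addrC mulrC.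
by rewrite divfK ?lt0r_neq0.
Unshelve. all: by end_near. Qed.

End vint.

(** * Uniqueness of the integral and its behaviour under affine maps *)

Section vint_affine.
Context {R : realType} {k : scalars} {T : metricType R}.
Context {X : normedModType (scalar_field R k)}.
Variable dot : {dot X for @scalar_conj R k}.
Hypothesis normE : forall x : X, `|x| ^+ 2 = dot x x.
Variable mu : set T -> X.
Hypothesis mu_sigma : vector_sigma_additive mu.
Variable V : R.
Hypothesis muV : (var_norm mu <= V%:E)%E.
Local Notation K := (scalar_field R k).
Implicit Types (f g : T -> X) (l : K).

(** By linearity $l'-l$ is an integral of $-f+f=0$, hence bounded by $V\cdot 0$. *)
Lemma is_vint_unique f l l' : is_vint dot f mu l -> is_vint dot f mu l' -> l = l'.
Proof.
move=> fl fl'; have := is_vintZD dot mu (-1) f f l l' fl fl'.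
have -> : (fun t => -1 *: f t + f t) = (fun=> 0).
  by apply/funext => t; rewrite scaleN1r addNr.
move=> fl0; have z (t : T) : rnorm (0 : X) <= 0 by rewrite rnorm0.
have := is_vint_le dot normE mu mu_sigma V muV _ _ 0 (lexx 0) z fl0; rewrite mulr0.
move=> ll'; have /eqP : -1 * l + l' = 0.
  by apply: (@rnorm_eq0 R k K^o); apply/eqP; rewrite eq_le ll' (@rnorm_ge0 R k K^o).
by rewrite mulN1r addrC subr_eq0 => /eqP.
Qed.

Lemma vintE f l : is_vint dot f mu l -> vint dot f mu = l.
Proof. by move=> fl; apply: xget_unique => // l' /(is_vint_unique f l' l)->. Qed.

Lemma vint_le f (M : R) : 0 <= M -> (forall t, rnorm (f t) <= M) ->
  scalar_Re `|vint dot f mu| <= V * M.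
Proof.
(* If f has no integral, [vint] is the default 0 and the bound reads [0 <= V * M]. *)
move=> M0 fM; rewrite /vint; case: xgetP => [l _ fl|_].
  exact: (is_vint_le dot normE mu).
rewrite [leLHS](@rnorm0 R k K^o) mulr_ge0//.
by rewrite -lee_fin (le_trans _ muV)// var_norm_ge0.
Qed.

(* When [f] has no integral the affine image has none either, and both sides
   take the default value [0]. *)
Lemma vint_affine f (a : K) b : mu setT = 0 -> a != 0 ->
  vint dot (fun t => a *: f t + b) mu = a * vint dot f mu.
Proof.
move=> mu0 a0; have [[l fl]|nf] := pselect (exists l, is_vint dot f mu l).
  rewrite (vintE f l fl); apply: vintE.
  have := is_vintZD dot mu a f _ l _ fl (is_vint_cst dot mu b).
  by rewrite mu0 linear0r addr0.
rewrite /vint !xgetPN ?mulr0// => l fl; apply: nf; first by exists l.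
(* Inverting the affine map turns an integral of $af+b$ into one of f. *)
exists (a^-1 * l + dot (- (a^-1 *: b)) (mu setT)).
have := is_vintZD dot mu a^-1 _ _ l _ fl (is_vint_cst dot mu (- (a^-1 *: b))).
congr is_vint; apply/funext => t.
by rewrite scalerDr scalerA mulVf// scale1r addrK.
Qed.

End vint_affine.

(** * Finiteness of the diameter *)

Section diameter.
Context {R : realType} (T : metricType R).
Hypothesis T_compact : compact [set: T].

Lemma mdist_le_diam (x y : T) : ((mdist x y)%:E <= diam T)%E.
Proof. by apply: ereal_sup_ubound; exists (x, y). Qed.

(** Compactness makes the local bounds on the distance to t0 uniform: one M serves all points, and
    the diameter is at most 2M. *)
Lemma compact_diam_fin : T -> diam T \is a fin_num.
Proof.
move=> t0; have : \forall M \near +oo, [set: T] `<=` [set x | mdist t0 x <= M].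
  move/compact_near_coveringP : T_compact; apply => x _.
  (* On the unit ball around x, every $M\ge d(t_0,x)+1$ bounds the distance to t0. *)
  exists (ball x 1, [set M | mdist t0 x + 1 <= M]) => /=.
    by split; [exact: nbhsx_ballx|apply: nbhs_pinfty_ge; exact: num_real].
  move=> [y M] [/=]; rewrite ballEmdist /= => xy xM.
  by rewrite (le_trans (metric_triangle t0 x y))// (le_trans _ xM)// lerD2l ltW.
case/filter_ex => M t0M.
rewrite fin_numElt; apply/andP; split.
  by apply: lt_le_trans (mdist_le_diam t0 t0); exact: ltNyr.
apply: (@le_lt_trans _ _ (M + M)%:E); last exact: ltry.
apply: ge_ereal_sup => _ [[x y] _ <-]; rewrite lee_fin /=.
rewrite (le_trans (metric_triangle x t0 y))// lerD//; last exact: t0M.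
by rewrite metric_sym; exact: t0M.
Qed.

End diameter.

(** * Lipschitz functions and their normalization *)

Section lipschitz.
Context {R : realType} {k : scalars} {T : metricType R}.
Context {X : normedModType (scalar_field R k)}.
Implicit Types f : T -> X.

(** A point of T excludes the empty supremum, which is $-\infty$. *)
Lemma sup_norm_ge0 f : T -> (0 <= sup_norm f)%E.
Proof.
move=> t; apply: le_ereal_sup_tmp; exists (rnorm (f t))%:E; first by exists t.
by rewrite lee_fin rnorm_ge0.
Qed.

(** The infimum [lip_norm] may be approached by constants slightly above 1; the excess
    $e/(d(x,y)+1)$ costs at most e at the pair x, y. *)
Lemma L1_lipschitz f x y : L1 f -> rnorm (f x - f y) <= mdist x y.
Proof.
move=> [_ f1]; apply/ler_addgt0Pr => e e0.
have d0 := mdist_ge0 x y; have d10 : 0 < mdist x y + 1 by rewrite ltr_wpDl.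
have : (lip_norm f < (1 + e / (mdist x y + 1))%:E)%E.
  by rewrite (le_lt_trans f1)// lte_fin ltrDl divr_gt0.
move=> /ereal_inf_lt[_ [L [L0 fL] <-]]; rewrite lte_fin => /ltW L1.
apply: le_trans (fL x y) _; apply: le_trans (ler_wpM2r d0 L1) _.
rewrite mulrDl mul1r lerD2l mulrAC ler_pdivrMr// ler_wpM2l ?(ltW e0)//.
by rewrite lerDl.
Qed.

Lemma sub_BL1_L1 : T -> @BL1 R k T X `<=` L1.
Proof.
move=> t f [fL f1]; split=> //; apply: le_trans f1.
by rewrite leeDr// sup_norm_ge0.
Qed.

(** Vanishing at t0 bounds the sup norm by $D/(D+1)$, and the Lipschitz constant is at most
    $1/(D+1)$; the two shares add up to 1. The form $af+b$ is the one [vint_affine] handles. *)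
Lemma L1_normalized f t0 (D : R) : (forall x y : T, mdist x y <= D) -> L1 f ->
  BL1 (fun t => scalar_of_real k (D + 1)^-1 *: f t -
                scalar_of_real k (D + 1)^-1 *: f t0).
Proof.
move=> TD f1; have D0 : 0 <= D := le_trans (mdist_ge0 t0 t0) (TD t0 t0).
have D10 : 0 < D + 1 by rewrite ltr_wpDl.
set g := fun t => _.
have gB x y : rnorm (g x - g y) <= (D + 1)^-1 * mdist x y.
  rewrite /g opprB addrA subrK -scalerBr rnormZ ger0_norm.
    by rewrite scalar_of_realK ler_wpM2l ?L1_lipschitz// invr_ge0 ltW.
  by rewrite ltW// scalar_of_real_gt0 invr_gt0.
have gL : lipschitz_const g (D + 1)^-1 by split; rewrite // invr_ge0 ltW.
split; first by exists (D + 1)^-1.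
have -> : 1%E = (D * (D + 1)^-1 + (D + 1)^-1)%:E.
  by rewrite -[X in _ + X]mul1r -mulrDl divff// lt0r_neq0.
rewrite EFinD leeD//; last by apply: ereal_inf_lbound; exists (D + 1)^-1.
apply: ge_ereal_sup => _ [t _ <-]; rewrite lee_fin.
have := gB t t0; rewrite [g t0]subrr subr0 => /le_trans; apply.
by rewrite mulrC ler_wpM2r ?TD// invr_ge0 ltW.
Qed.

End lipschitz.

(** * Comparison of the two norms *)

Theorem theorem18 (R : realType) (k : scalars) (T : metricType R)
    (X : completeNormedModType (scalar_field R k))
    (dot : {dot X for @scalar_conj R k})
    (T_compact : compact [set: T])
    (T_two : exists x y : T, x != y)
    (X_nonzero : exists x : X, x != 0)
    (X_hilbert : forall x : X, `|x| ^+ 2 = dot x x) :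
  equivalent_norms_on (@cabv0 R k T X) (mk_norm dot) (mk_star_norm dot) /\
  forall mu : set T -> X, cabv0 mu ->
    ((mk_norm dot mu <= mk_star_norm dot mu)%E /\
     (mk_star_norm dot mu <= mk_norm dot mu * (diam T + 1))%E) /\
    ((mk_norm dot mu <= mk_star_norm dot mu)%E /\
     (mk_star_norm dot mu <= var_norm mu * diam T)%E).
Proof.
have [t0 _] := T_two.
have diamE := fineK (compact_diam_fin T T_compact t0).
set D := fine (diam T) in diamE.
have TD (x y : T) : mdist x y <= D.
  by rewrite -lee_fin diamE; exact: mdist_le_diam.
have D0 : 0 <= D := le_trans (mdist_ge0 t0 t0) (TD t0 t0).
have D10 : 0 < D + 1 by rewrite ltr_wpDl.
have mk_le (mu : set T -> X) : (mk_norm dot mu <= mk_star_norm dot mu)%E.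
  by apply: ereal_sup_le => _ [f /(sub_BL1_L1 t0) fL <-]; exists f.
have star_le (mu : set T -> X) : cabv0 mu ->
    (mk_star_norm dot mu <= mk_norm dot mu * (diam T + 1))%E.
  move=> [/[dup]/cabv_var_normE varE [mu_sigma _] mu0]; rewrite -diamE -EFinD.
  (* Dividing by D + 1 turns the value at f into the value at the normalized function g, a
     competitor in [mk_norm]. *)
  apply: ge_ereal_sup => _ [f fL <-]; rewrite -lee_pdivrMr//.
  have gL := L1_normalized f t0 D TD fL; set g := fun t => _ in gL.
  apply: ereal_sup_ubound; exists g => //.
  have a0 : 0 < scalar_of_real k (D + 1)^-1.
    by rewrite scalar_of_real_gt0 invr_gt0.
  have muV : (var_norm mu <= (fine (var_norm mu))%:E)%E by rewrite -varE.
  rewrite (vint_affine dot X_hilbert mu mu_sigma _ muV _ _ _ mu0) ?lt0r_neq0//.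
  by rewrite normrM scalar_ReM// gtr0_norm// scalar_of_realK mulrC.
have star_le_var (mu : set T -> X) : cabv0 mu ->
    (mk_star_norm dot mu <= var_norm mu * diam T)%E.
  move=> [/[dup]/cabv_var_normE varE [mu_sigma _] mu0].
  have muV : (var_norm mu <= (fine (var_norm mu))%:E)%E by rewrite -varE.
  apply: ge_ereal_sup => _ [f fL <-]; rewrite varE -diamE -EFinM lee_fin.
  (* As $\mu(T)=0$, f may be replaced by $f-f(t_0)$, whose norm is at most D everywhere. *)
  have := vint_affine dot X_hilbert mu mu_sigma _ muV f 1 (- f t0) mu0 (oner_neq0 _).
  rewrite mul1r => <-; apply: (vint_le dot X_hilbert mu mu_sigma) => // t.
  by rewrite scale1r (le_trans (L1_lipschitz _ _ _ fL)).
split; last by move=> mu muP; split; split=> //; [exact: star_le|exact: star_le_var].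
exists 1, (D + 1); split=> // mu muP; rewrite mul1e; split=> //.
by rewrite EFinD diamE muleC; exact: star_le.
Qed.
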